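(* Let $r\ge0$ and $m,n>1$ be integers and let $p>0$ be real. Then \[\sum_{1\le k_m<\cdots<k_1\le n}\frac{1}{(k_1+r)^p\cdots(k_m+r)^p}=\sum_{\substack{i+j=m\\ i,j\ge0}}(-1)^i\,\zeta_r^\star(\{p\}_i)\,\zeta_{n+r}(\{p\}_j),\] and \[\sum_{1\le k_m\le\cdots\le k_1\le n}\frac{1}{(k_1+r)^p\cdots(k_m+r)^p}=\sum_{\substack{i+j=m\\ i,j\ge0}}(-1)^i\,\zeta_r(\{p\}_i)\,\zeta^\star_{n+r}(\{p\}_j).\]
   Context: $\{p\}_q$ denotes $p$ repeated $q$ times. For a positive integer $N$, $\zeta_N(\{p\}_j)=\sum_{N\ge n_1>\cdots>n_j\ge1}\frac{1}{(n_1\cdots n_j)^p}$ and $\zeta_N^\star(\{p\}_i)=\sum_{N\ge n_1\ge\cdots\ge n_i\ge1}\frac{1}{(n_1\cdots n_i)^p}$, with empty-argument values equal to $1$ and $\zeta_N(\{p\}_j)=0$ if $N<j$. For $N=0$: $\zeta_0(\emptyset)=\zeta_0^\star(\emptyset)=1$ and $\zeta_0(\{p\}_j)=\zeta_0^\star(\{p\}_i)=0$ for $i,j\ge1$. *)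

(* Defs.v *)
From mathcomp Require Import all_boot all_order all_algebra.
From mathcomp Require Import reals exp.
Set Implicit Arguments.
Unset Strict Implicit.
Unset Printing Implicit Defensive.
Import Order.TTheory GRing.Theory Num.Theory.
Local Open Scope ring_scope.

(* Tuples (k_1, ..., k_j) of naturals with N >= k_1 > ... > k_j >= 1; 'I_N.+1
   gives the upper bound N, so that entries carry their actual value.
   For j = 0 this is the singleton {[tuple]}, whatever N is (including 0). *)
Definition decr_tuples (N j : nat) : {set j.-tuple 'I_N.+1} :=
  [set k : j.-tuple 'I_N.+1 |
    sorted gtn [seq val x | x <- k] && [forall l, (0 < tnth k l)%N]].

(* Same with N >= k_1 >= ... >= k_j >= 1. *)
Definition nonincr_tuples (N j : nat) : {set j.-tuple 'I_N.+1} :=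
  [set k : j.-tuple 'I_N.+1 |
    sorted geq [seq val x | x <- k] && [forall l, (0 < tnth k l)%N]].

(* zeta_N({p}_j).  The conventions for j = 0 (value 1), for N < j (value 0) and
   for N = 0 result from the index set having one, resp. no, element. *)
Definition mzeta (R : realType) (N : nat) (p : R) (j : nat) : R :=
  \sum_(k in decr_tuples N j) 1 / (\prod_(l < j) (tnth k l)%:R) `^ p.

(* zeta^star_N({p}_i) *)
Definition mzeta_star (R : realType) (N : nat) (p : R) (i : nat) : R :=
  \sum_(k in nonincr_tuples N i) 1 / (\prod_(l < i) (tnth k l)%:R) `^ p.

(* Main.v *)
Require Import Defs.
From mathcomp Require Import all_boot all_order all_algebra.
From mathcomp Require Import reals exp.
From mathcomp Require Import zify ring.
Set Implicit Arguments.
Unset Strict Implicit.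
Unset Printing Implicit Defensive.
Import Order.TTheory GRing.Theory Num.Theory.
Local Open Scope ring_scope.

(* With weights a_k, the sums over decreasing and over nonincreasing tuples are
   the coefficients of E_N(t) = prod_(k <= N) (1 + a_k t) and
   H_N(t) = prod_(k <= N) (1 - a_k t)^-1 respectively.  For a_k = 1 / k^p the
   two identities compare coefficients in
     prod_(r < k <= n + r) (1 + a_k t) = H_r(- t) E_(n + r)(t),
     prod_(r < k <= n + r) (1 - a_k t)^-1 = E_r(- t) H_(n + r)(t). *)

Section PowerSeries.
Variable R : comNzRingType.
Implicit Types (u v : nat -> R) (a : R).

Definition convolution u v m : R := \sum_(i < m.+1) u i * v (m - i)%N.

(* The coefficients of (1 + a t) u(t). *)
Definition mul_linear a u j : R := u j + a * (if j is i.+1 then u i else 0).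

Definition alternate u i : R := (-1) ^+ i * u i.

Lemma eq_convolution u u' v v' :
  u =1 u' -> v =1 v' -> convolution u v =1 convolution u' v'.
Proof. by move=> uu vv m; apply: eq_bigr => i _; rewrite uu vv. Qed.

Lemma convolutionC u v : convolution u v =1 convolution v u.
Proof.
move=> m; rewrite /convolution (reindex_inj rev_ord_inj) /=.
apply: eq_bigr => i _; rewrite mulrC subSS subKn //.
by rewrite -ltnS.
Qed.

Lemma eq_mul_linear a u v : u =1 v -> mul_linear a u =1 mul_linear a v.
Proof. by move=> uv [|j]; rewrite /mul_linear !uv. Qed.

(** The constant term of [1 + a t] is 1, so the coefficients of the other factor are recovered one
    degree at a time. This replaces division by power series. *)
Lemma mul_linear_inj a u v : mul_linear a u =1 mul_linear a v -> u =1 v.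
Proof.
move=> uv; elim=> [|j IHj]; first by have := uv 0; rewrite /mul_linear !mulr0 !addr0.
by have := uv j.+1; rewrite /mul_linear IHj => /addIr.
Qed.

Lemma convolution_mul_linearl a u v :
  convolution (mul_linear a u) v =1 mul_linear a (convolution u v).
Proof.
case=> [|m]; rewrite /convolution /mul_linear.
  by rewrite !big_ord1 !mulr0 !addr0.
under eq_bigr do rewrite mulrDl.
rewrite big_split /=; congr (_ + _).
rewrite big_ord_recl mulr0 mul0r add0r mulr_sumr.
by apply: eq_bigr => i _; rewrite /= subSS mulrA.
Qed.

Lemma convolution_mul_linearr a u v :
  convolution u (mul_linear a v) =1 mul_linear a (convolution u v).
Proof.
move=> m; rewrite convolutionC convolution_mul_linearl.
by apply: eq_mul_linear; apply: convolutionC.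
Qed.

Lemma alternate_mul_linear a u :
  alternate (mul_linear a u) =1 mul_linear (- a) (alternate u).
Proof.
case=> [|j]; rewrite /alternate /mul_linear ?mulr0 ?addr0 //.
by rewrite exprS; ring.
Qed.

Lemma alternate_eq u v : u =1 v -> alternate u =1 alternate v.
Proof. by move=> uv i; rewrite /alternate uv. Qed.

End PowerSeries.

Section NestedSums.
Variable R : comNzRingType.
Implicit Types (a : nat -> R) (s : bool).

(* Sums of a_(k_1) ... a_(k_j) over N >= k_1 > ... > k_j >= 1 if s = false, and
   over N >= k_1 >= ... >= k_j >= 1 if s = true. *)
Fixpoint nested_sum s a N j {struct j} : R :=
  if j is i.+1 then \sum_(k < N) a k.+1 * nested_sum s a (k + s)%N i else 1.

Lemma nested_sum0 s a j : nested_sum s a 0 j = (j == 0)%:R.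
Proof. by case: j => [|j] //=; rewrite big_ord0. Qed.

(** The terms are split by whether the largest index [k_1] equals [N.+1]. *)
Lemma nested_sum_strictS a N :
  nested_sum false a N.+1 =1 mul_linear (a N.+1) (nested_sum false a N).
Proof.
case=> [|j]; rewrite /mul_linear /= ?mulr0 ?addr0 //.
by rewrite big_ord_recr /= addn0.
Qed.

Lemma nested_sum_largeS a N :
  nested_sum true a N =1 mul_linear (- a N.+1) (nested_sum true a N.+1).
Proof.
case=> [|j]; rewrite /mul_linear /= ?mulr0 ?addr0 //.
by rewrite big_ord_recr /= addn1; ring.
Qed.

Lemma convolution_delta m :
  convolution (fun i => (i == 0)%:R) (fun i => (i == 0)%:R) m = (m == 0)%:R :> R.
Proof.
rewrite /convolution big_ord_recl /= mul1r subn0 big1 ?addr0 // => i _.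
by rewrite mul0r.
Qed.

Lemma alternate_delta : alternate (fun i => (i == 0)%:R : R) =1 (fun i => (i == 0)%:R).
Proof. by case=> [|i]; rewrite /alternate ?mulr0 ?mulr1. Qed.

(** This is [H_N(- t) E_N(t) = 1] or [E_N(- t) H_N(t) = 1]. From [N] to [N.+1], the linear factor
    gained by [E] is moved across the product, where it turns [H_(N + 1)] back into [H_N]. *)
Lemma convolution_nested_sumV s a N m :
  convolution (alternate (nested_sum s a N)) (nested_sum (~~ s) a N) m = (m == 0)%:R.
Proof.
elim: N m => [|N IHN] m.
  rewrite -convolution_delta; apply: eq_convolution => i; last exact: nested_sum0.
  by rewrite -alternate_delta /alternate nested_sum0.
rewrite -{}IHN; case: s => /=.
  rewrite (eq_convolution (frefl _) (nested_sum_strictS a N)).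
  rewrite convolution_mul_linearr -convolution_mul_linearl.
  apply: eq_convolution => // i.
  by rewrite (alternate_eq (nested_sum_largeS a N)) alternate_mul_linear opprK.
rewrite (eq_convolution (alternate_eq (nested_sum_strictS a N)) (frefl _)).
rewrite (eq_convolution (@alternate_mul_linear _ _ _) (frefl _)).
rewrite convolution_mul_linearl -convolution_mul_linearr.
by apply: eq_convolution => // i; rewrite -nested_sum_largeS.
Qed.

Lemma nested_sum_shift s a r n :
  nested_sum s (fun k => a (k + r)%N) n
    =1 convolution (alternate (nested_sum (~~ s) a r)) (nested_sum s a (n + r)).
Proof.
elim: n => [|n IHn] m.
  by rewrite nested_sum0 add0n -{2}[s]negbK convolution_nested_sumV.
case: s IHn m => /= IHn.
  (* For [H] the new factor is an inverse, so both sides are first multiplied by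
     [1 - a_(n + r + 1) t]. *)
  apply: (@mul_linear_inj _ (- a (n + r).+1)) => m.
  rewrite -convolution_mul_linearr -addSn.
  rewrite -(nested_sum_largeS (fun k => a (k + r)%N)) IHn.
  by apply: eq_convolution => // i; rewrite -nested_sum_largeS.
move=> m; rewrite nested_sum_strictS (eq_mul_linear _ IHn) -convolution_mul_linearr.
by apply: eq_convolution => // i; rewrite -nested_sum_strictS.
Qed.

End NestedSums.

Section Tuples.
Variable R : comNzRingType.
Implicit Types (a : nat -> R) (s : bool).

(** With [s] read as 0 or 1, one formula covers [gtn] and [geq]. *)
Definition descent s : rel nat := fun x y => (y < x + s)%N.

Lemma descent_trans s : transitive (descent s).
Proof. by rewrite /descent => y x z; lia. Qed.

Lemma big_tuple_cons (T : finType) j (P : pred (j.+1.-tuple T)) (F : j.+1.-tuple T -> R) :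
  \sum_(t | P t) F t
    = \sum_(x : T) \sum_(t : j.-tuple T | P (cons_tuple x t)) F (cons_tuple x t).
Proof.
rewrite pair_big_dep /=.
rewrite (reindex (fun z : T * j.-tuple T => cons_tuple z.1 z.2)) //=.
exists (fun t => (thead t, behead_tuple t)) => [[x t] _|t _] /=.
  by congr pair; apply/val_inj.
by rewrite [RHS]tuple_eta; apply/val_inj.
Qed.

(* The ambient bound M stays fixed while N decreases along the induction, so that
   the type of the tuples does not change. *)
Lemma bounded_tuple_sum s a M N j : (N <= M)%N ->
  \sum_(k : j.-tuple 'I_M.+1 |
      [&& sorted (descent s) (map val k), all (fun x : 'I_M.+1 => 0 < x)%N k
        & all (fun x : 'I_M.+1 => x <= N)%N k]) \prod_(x <- k) a x
    = nested_sum s a N j.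
Proof.
elim: j N => [|j IHj] N leNM /=.
  rewrite (big_pred1 [tuple]) ?big_nil // => k.
  by rewrite [k]tuple0 /=; apply/esym/eqP.
(* A head equal to 0 violates positivity; the other heads are [x.+1] with [x < M]. *)
rewrite big_tuple_cons big_ord_recl /= big_pred0 ?add0r; last first.
  by move=> t; rewrite /= andbF.
rewrite (big_ord_widen M (fun k => a k.+1 * nested_sum s a (k + s)%N j)) //.
rewrite [RHS]big_mkcond; apply: eq_bigr => x _; case: ifPn => [ltxN|leNx]; last first.
  by rewrite big_pred0 // => t; rewrite /= !andbF.
rewrite -IHj; last by case: (s) (ltn_ord x); lia.
rewrite mulr_sumr; apply: eq_big => [t|t _]; last by rewrite big_cons lift0.
(* By transitivity the head [x.+1] bounds every entry of the tail by [x + s], which is at most [N]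
   since [x < N]. So the bound [N] on the tail is absorbed. *)
rewrite /= path_sortedE; last exact: descent_trans.
rewrite all_map.
case: (sorted _ _); rewrite ?andbF ?andbT //=.
case: (all (fun y : 'I_M.+1 => 0 < y)%N _); rewrite ?andbF ?andbT //=.
rewrite -all_predI; apply: eq_all => y /=; rewrite /descent.
by case: (s) ltxN; rewrite /bump /=; lia.
Qed.

Lemma tuple_sum s a N j :
  \sum_(k in (if s then nonincr_tuples N j else decr_tuples N j))
      \prod_(l < j) a (tnth k l) = nested_sum s a N j.
Proof.
rewrite -(bounded_tuple_sum s a _ (leqnn N)).
apply: eq_big => [k|k _]; last by rewrite big_tuple.
have -> : all (fun x : 'I_N.+1 => x <= N)%N k by apply/allP => x _; rewrite -ltnS.
have <- : [forall l, 0 < tnth k l]%N = all (fun x : 'I_N.+1 => 0 < x)%N k.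
  by apply/forallP/all_tnthP.
rewrite andbT; case: s; rewrite inE; congr (_ && _); apply: eq_sorted => x y.
  by rewrite /descent addn1.
by rewrite /descent addn0.
Qed.

End Tuples.

Section Zeta.
Variables (R : realType) (p : R).

Lemma powR_prod (I : Type) (r : seq I) (F : I -> R) :
  (forall i, 0 <= F i) -> (\prod_(i <- r) F i) `^ p = \prod_(i <- r) F i `^ p.
Proof.
move=> F0; elim: r => [|i r IHr]; first by rewrite !big_nil powR1.
by rewrite !big_cons powRM ?IHr // prodr_ge0.
Qed.

Lemma mzetaE N j : mzeta N p j = nested_sum false (fun k => (k%:R `^ p)^-1 : R) N j.
Proof.
rewrite -tuple_sum; apply: eq_bigr => k _.
by rewrite div1r powR_prod // prodfV.
Qed.

Lemma mzeta_starE N j :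
  mzeta_star N p j = nested_sum true (fun k => (k%:R `^ p)^-1 : R) N j.
Proof.
rewrite -tuple_sum; apply: eq_bigr => k _.
by rewrite div1r powR_prod // prodfV.
Qed.

End Zeta.

Lemma sum_antidiagonal (V : nmodType) (m : nat) (F : nat -> nat -> V) :
  \sum_(i < m.+1) \sum_(j < m.+1 | (i + j == m)%N) F i j
    = \sum_(i < m.+1) F i (m - i)%N.
Proof.
apply: eq_bigr => i _; rewrite (big_pred1 (rev_ord i)) ?subSS // => j.
by rewrite /= -val_eqE /=; have := ltn_ord i; lia.
Qed.

Theorem theorem2p7 (R : realType) (r m n : nat) (p : R)
    (hm : (1 < m)%N) (hn : (1 < n)%N) (hp : 0 < p) :
  \sum_(k in decr_tuples n m) 1 / \prod_(l < m) ((tnth k l + r)%:R `^ p)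
    = \sum_(i < m.+1) \sum_(j < m.+1 | (i + j == m)%N)
        (-1) ^+ i * mzeta_star r p i * mzeta (n + r) p j
  /\
  \sum_(k in nonincr_tuples n m) 1 / \prod_(l < m) ((tnth k l + r)%:R `^ p)
    = \sum_(i < m.+1) \sum_(j < m.+1 | (i + j == m)%N)
        (-1) ^+ i * mzeta r p i * mzeta_star (n + r) p j.
Proof.
pose a k : R := (k%:R `^ p)^-1.
(* Both left-hand sides are nested sums for the shifted weights [a (k + r)]. *)
have shifted s : \sum_(k in (if s then nonincr_tuples n m else decr_tuples n m))
      1 / \prod_(l < m) ((tnth k l + r)%:R `^ p)
    = convolution (alternate (nested_sum (~~ s) a r)) (nested_sum s a (n + r)) m.
  rewrite -nested_sum_shift -tuple_sum; apply: eq_bigr => k _.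
  by rewrite div1r prodfV.
split.
  rewrite (shifted false).
  rewrite (sum_antidiagonal _ (fun i j => (-1) ^+ i * mzeta_star r p i * mzeta (n + r) p j)).
  by apply: eq_bigr => i _; rewrite mzeta_starE mzetaE.
rewrite (shifted true).
rewrite (sum_antidiagonal _ (fun i j => (-1) ^+ i * mzeta r p i * mzeta_star (n + r) p j)).
by apply: eq_bigr => i _; rewrite mzeta_starE mzetaE.
Qed.
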